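(* Let $k<n$ be positive integers and $m=n+k$. Let $L,R\in\mathbb C^{m\times m}$ be two unitary matrices, where $L$ is a proper unitary $k$-lower Hessenberg matrix and $R$ is a unitary $k$-upper Hessenberg matrix. Let $Q\in\mathbb C^{m\times m}$ be a block diagonal unitary upper Hessenberg matrix of the form $$Q=\begin{bmatrix}I_k&0\\0&\hat Q\end{bmatrix},$$ with $\hat Q$ an $n\times n$ unitary Hessenberg matrix. Let $F=Q+[I_k,0]^TZ^H$ be a unitary plus rank-$k$ matrix with $Z\in\mathbb C^{m\times k}$. Suppose that the matrix $\widehat A=LFR$ satisfies the block structure $$\widehat A=\begin{bmatrix}A&\ast\\0_{k,n}&0_{k,k}\end{bmatrix},$$ where $A$ is $n\times n$ and $\ast$ denotes an arbitrary $n\times k$ block (i.e. the last $k$ rows of $\widehat A$ vanish). Then $\widehat A$ is an upper Hessenberg matrix.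
   Context: A matrix $H=(h_{ij})\in\mathbb C^{m\times m}$ is $k$-upper Hessenberg if $h_{ij}=0$ when $i>j+k$, and $k$-lower Hessenberg if $h_{ij}=0$ when $j>i+k$. A $k$-upper (resp. $k$-lower) Hessenberg matrix is called proper if its outermost entries are nonzero, i.e. $h_{j+k,j}\ne0$ (resp. $h_{j,j+k}\neq 0$) for $1\le j\le m-k$. Upper Hessenberg means $1$-upper Hessenberg. $[I_k,0]^T\in\mathbb C^{m\times k}$ consists of the first $k$ columns of $I_m$; $M^H$ is the conjugate transpose of $M$. *)

(* Defs.v *)
From mathcomp Require Import all_boot all_order all_algebra.

Set Implicit Arguments.
Unset Strict Implicit.
Unset Printing Implicit Defensive.

Import GRing.Theory.
Local Open Scope ring_scope.

Definition upper_hessenberg (V : nmodType) (m k : nat) (H : 'M[V]_m) : Prop :=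
  forall i j : 'I_m, (j + k < i)%N -> H i j = 0.

Definition lower_hessenberg (V : nmodType) (m k : nat) (H : 'M[V]_m) : Prop :=
  forall i j : 'I_m, (i + k < j)%N -> H i j = 0.

(* Since j ranges over 'I_m, the equation j = i + k already restricts i to the
   indices for which the outermost entry of row i exists. *)
Definition proper_lower_hessenberg (V : nmodType) (m k : nat) (H : 'M[V]_m) :
    Prop :=
  lower_hessenberg k H /\
  forall i j : 'I_m, j = (i + k)%N :> nat -> H i j != 0.

(* The block matrix diag(I_k, Qhat) naturally has size k + n; the cast moves it
   to size n + k, the size at which the n + k block splitting is available. *)
Definition id_block_diag (T : pzRingType) (n k : nat) (Qhat : 'M[T]_n) :
    'M[T]_(n + k) :=
  castmx (addnC k n, addnC k n)
    (block_mx (1%:M : 'M[T]_k) 0 0 Qhat).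

(* Main.v *)
(* Multiplying [Ahat = L F R] by [L^H] gives [L^H Ahat = F R].  The rows of [F]
   from index [k] on are those of [Q], so there [F R] agrees with the
   (k+1)-upper Hessenberg matrix [Q R].  As the last [k] rows of [Ahat] vanish,
   the same rows of [L^H Ahat] involve only the block of [L^H] which is upper
   triangular with nonzero diagonal, since [L] is proper.  Back substitution from
   the last row upwards then shows that [Ahat] is upper Hessenberg. *)
Require Import Defs.
From mathcomp Require Import all_boot all_order all_algebra.
From mathcomp Require Import spectral sesquilinear reals complex.

Local Open Scope ring_scope.
Local Open Scope complex_scope.
Local Open Scope sesquilinear_scope.

Import Order.TTheory GRing.Theory Num.Theory.

Lemma upper_hessenberg_mul (S : pzRingType) (m p q : nat) (G H : 'M[S]_m) :
  upper_hessenberg p G -> upper_hessenberg q H ->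
  upper_hessenberg (p + q) (G *m H).
Proof.
move=> hG hH i j lt_ji; rewrite mxE big1 // => l _.
have [lt_li|le_il] := ltnP (l + p) i; first by rewrite hG ?mul0r.
rewrite hH ?mulr0 // -(ltn_add2r p).
by apply: leq_trans le_il; rewrite -addnA [(q + p)%N]addnC.
Qed.

Lemma add_pid_mul_row (S : pzRingType) (m k : nat) (G : 'M[S]_m)
    (W : 'M[S]_(k, m)) (i l : 'I_m) :
  (k <= i)%N -> (G + (pid_mx k : 'M_(m, k)) *m W) i l = G i l.
Proof.
move=> le_ki; rewrite !mxE big1 ?addr0 // => p _.
by rewrite mxE [(i < k)%N]ltnNge le_ki andbF mul0r.
Qed.

(** Entry [(i + k, j)] of [L^t* *m X] sums the conjugate of [L p (i + k)] times [X p j] over [p].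
    Terms with [p < i] vanish by the shape of [L], those with [p > i] by induction on [m - i], and
    properness makes the coefficient of [X i j] nonzero. *)
Lemma proper_lower_back_substitution (C : numClosedFieldType) (m k d : nat)
    (L X : 'M[C]_m) :
  proper_lower_hessenberg k L ->
  (forall i j : 'I_m, (m <= i + k)%N -> X i j = 0) ->
  upper_hessenberg (d + k) (L^t* *m X) ->
  upper_hessenberg d X.
Proof.
move=> [hL hLn0] hX hLX i j; have [s] := ubnP (m - i).
elim: s i => // s IHs i lt_s lt_ji.
have [/hX->//|lt_ikm] := leqP m (i + k).
pose r := Ordinal lt_ikm.
have : (L^t* *m X) r j = 0 by apply: hLX; rewrite addnA ltn_add2r.
rewrite mxE (bigD1 i) //= big1 ?addr0 => [|p neq_pi].
  move/eqP; rewrite !mxE mulf_eq0 conjC_eq0 => /orP[Li0|/eqP//].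
  by have := hLn0 i r erefl; rewrite Li0.
have [lt_pi|lt_ip|/val_inj eq_pi] := ltngtP p i; last by rewrite eq_pi eqxx in neq_pi.
  by rewrite !mxE hL ?ltn_add2r // conjC0 mul0r.
rewrite IHs ?mulr0 //; last exact: ltn_trans lt_ip.
by apply: leq_trans (_ : m - i <= s)%N; [apply: ltn_sub2l|].
Qed.

Theorem theorem3p3 (K : realType) (n k : nat) (k_gt0 : (0 < k)%N)
    (k_lt_n : (k < n)%N)
    (L R Q F : 'M[K[i]]_(n + k)) (Qhat : 'M[K[i]]_n) (Z : 'M[K[i]]_(n + k, k))
    (Ahat : 'M[K[i]]_(n + k)) (A : 'M[K[i]]_n) (B : 'M[K[i]]_(n, k))
    (L_unitary : L \is unitarymx)
    (L_hess : proper_lower_hessenberg k L)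
    (R_unitary : R \is unitarymx)
    (R_hess : upper_hessenberg k R)
    (Q_unitary : Q \is unitarymx)
    (Q_hess : upper_hessenberg 1 Q)
    (Qhat_unitary : Qhat \is unitarymx)
    (Qhat_hess : upper_hessenberg 1 Qhat)
    (Q_def : Q = id_block_diag k Qhat)
    (* [pid_mx k] consists of the first k columns of the identity matrix *)
    (F_def : F = Q + (pid_mx k : 'M_(n + k, k)) *m Z^t*)
    (F_rank : \rank ((pid_mx k : 'M_(n + k, k)) *m Z^t*) = k)
    (Ahat_def : Ahat = L *m F *m R)
    (Ahat_block : Ahat = block_mx A B (0 : 'M_(k, n)) (0 : 'M_(k, k))) :
  upper_hessenberg 1 Ahat.
Proof.
apply: (proper_lower_back_substitution _ _ _ _ _ _ L_hess) => [i j|i j lt_ji].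
  rewrite leq_add2r Ahat_block => le_ni.
  have lt_ik : (i - n < k)%N by rewrite ltn_subLR.
  have -> : i = rshift n (Ordinal lt_ik) by apply: val_inj; rewrite /= subnKC.
  by rewrite block_mxEh mxE; case: splitP => j' _; rewrite col_mxEd mxE.
(* Unitarity is stated as [L *m L^t* = 1%:M]; as [L] is square, the other order follows. *)
have LL1 : L^t* *m L = 1%:M by apply: mulmx1C; apply/unitarymxP.
(* Only entries with [j + (1 + k) < i] matter, so [k <= i] and the rank-[k] term misses row [i]. *)
have -> : (L^t* *m Ahat) i j = (Q *m R) i j.
  rewrite Ahat_def !mulmxA LL1 mul1mx mxE [RHS]mxE; apply: eq_bigr => l _.
  rewrite F_def add_pid_mul_row //.
  by apply: leq_trans (ltnW lt_ji); rewrite addnA leq_addl.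
exact: (upper_hessenberg_mul _ _ _ _ _ _ Q_hess R_hess).
Qed.
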